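(* For every integer $n\ge0$, the following divisibilities hold in $\mathbb{Z}[w,w^{-1}]$: $\Phi_5(w)$ divides $\operatorname{t-core-crank}_{5n+4}(w)$ (with $t=5$), $\Phi_7(w)$ divides $\operatorname{t-core-crank}_{7n+5}(w)$ (with $t=7$), and $\Phi_{11}(w)$ divides $\operatorname{t-core-crank}_{11n+6}(w)$ (with $t=11$).
   Context: $\Phi_\ell(w)$ denotes the $\ell$-th cyclotomic polynomial. A Laurent polynomial $\Phi(w)$ divides $f(w)$ in $\mathbb{Z}[w,w^{-1}]$ if $f=g\Phi$ for some $g\in\mathbb{Z}[w,w^{-1}]$. For a partition $\lambda=(\lambda_1,\dots,\lambda_s)$ with conjugate $\lambda'$, the hook length of the node in row $k$ and column $j$ of its Ferrers–Young diagram is $h(k,j)=(\lambda_k-k)+(\lambda'_j-j)+1$. A $t$-core partition is a partition none of whose hook lengths is divisible by $t$. There is a bijection $\phi_2$ (Garvan–Kim–Stanton, Bijection 2) from the set of $t$-core partitions to $\{\vec n=(n_0,\dots,n_{t-1})\in\mathbb{Z}^t: n_0+\cdots+n_{t-1}=0\}$ such that if $\phi_2(\tilde\lambda)=\vec n$ then $$|\tilde\lambda|=\frac{t\,\|\vec n\|^2}{2}+\vec b\cdot\vec n,\qquad \vec b=(0,1,\dots,t-1),$$ where $|\tilde\lambda|$ is the sum of the parts and $\|\vec n\|^2=\sum_i n_i^2$. (The counts defined below depend only on this size formula, not on the particular choice of bijection satisfying it.) For $t\in\{5,7,11\}$, the $t$-core crank of a $t$-core partition $\tilde\lambda$ with $\phi_2(\tilde\lambda)=\vec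 n$ is the residue modulo $t$ (with representative in $\{0,1,\dots,t-1\}$) of - $4n_0+n_1+n_3+4n_4$ for $t=5$; - $4n_0+2n_1+n_2+n_4+2n_5+4n_6$ for $t=7$; - $4n_0+9n_1+5n_2+3n_3+n_4+n_6+3n_7+5n_8+9n_9+4n_{10}$ for $t=11$. Let $c_t(m,n)$ be the number of $t$-core partitions of $n$ with $t$-core crank $m$, and set $\operatorname{t-core-crank}_n(w)=\sum_m c_t(m,n)w^m$ for $n\ge0$. *)

(* Defs.v *)
From HB Require Import structures.
From mathcomp Require Import all_boot all_order all_algebra all_field.

Set Implicit Arguments.
Unset Strict Implicit.
Unset Printing Implicit Defensive.

Import Order.TTheory GRing.Theory Num.Theory.
Local Open Scope ring_scope.

Definition is_partition (la : seq nat) : bool :=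
  sorted geq la && (0%N \notin la).

(* Rows and columns are numbered from 1; [part la k] is 0 beyond the last
   part, and neither function is meant to be used at index 0. *)
Definition part (la : seq nat) (k : nat) : nat := nth 0%N la k.-1.
Definition conj_part (la : seq nat) (j : nat) : nat :=
  count (fun x => (j <= x)%N) la.

Definition hook (la : seq nat) (k j : nat) : int :=
  ((part la k)%:Z - k%:Z) + ((conj_part la j)%:Z - j%:Z) + 1.

Definition is_core (t : nat) (la : seq nat) : bool :=
  all (fun k => all (fun j => ~~ (t%:Z %| hook la k j)%Z)
                    (iota 1 (part la k)))
      (iota 1 (size la)).

(* The bijection phi_2 is Bijection 2 of Garvan, Kim and Stanton, "Cranks and
   t-cores".  The cell (k, j) is coloured by j - k mod t and lies in the region
   r determined by t (r - 1) <= j - k < t r.  The diagram is extended by a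
   column 0 of infinitely many cells, so that the last cell of row k is
   (k, la_k) for every k >= 1, empty rows included.  The coordinate n_i is the
   largest region containing the last cell, of colour i, of some row. *)
Definition end_diff (la : seq nat) (k : nat) : int := (part la k)%:Z - k%:Z.

Definition end_region (t : nat) (la : seq nat) (k : nat) : int :=
  (end_diff la k %/ t%:Z)%Z + 1.

(* The rows 1, ..., size la + t suffice: the last t of them are empty, hence
   realise every colour, and both [end_diff] and [end_region] are nonincreasing
   in k.  For the same reason the last region is a neutral seed for the max. *)
Definition phi2 (t : nat) (la : seq nat) : 'rV[int]_t :=
  \row_(i < t)
    \big[Num.max/end_region t la (size la + t)]_(1 <= k < (size la + t).+1
        | (end_diff la k %% t%:Z)%Z == i%:Z) end_region t la k.

Definition crank_weights (t : nat) : seq int :=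
  match t with
  | 5 => [:: 4; 1; 0; 1; 4]
  | 7 => [:: 4; 2; 1; 0; 1; 2; 4]
  | 11 => [:: 4; 9; 5; 3; 1; 0; 1; 3; 5; 9; 4]
  | _ => [::]
  end.

Definition core_crank (t : nat) (la : seq nat) : int :=
  ((\sum_(i < t) (crank_weights t)`_i * phi2 t la 0 i) %% t%:Z)%Z.

(* A partition of n has at most n parts, each at most n. *)
Definition core_count (t m n : nat) : nat :=
  #|[set s : {bseq n of 'I_n.+1} |
      let la := [seq val x | x <- s] in
      [&& is_partition la, sumn la == n, is_core t la
        & core_crank t la == m%:Z]]|.

Definition core_crank_poly (t n : nat) : {poly int} :=
  \sum_(m < t) (core_count t m n)%:R *: 'X^m.

Notation "x %:F" := (FracField.tofrac x) : ring_scope.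

(* Z[w, w^-1], as the subring of the elements p / w^k of the fraction field of
   Z[w]. *)
Definition is_laurent (f : {fraction {poly int}}) : Prop :=
  exists (p : {poly int}) (k : nat), f = p%:F / 'X^k%:F.

Definition laurent_dvd (d f : {fraction {poly int}}) : Prop :=
  exists2 g : {fraction {poly int}}, is_laurent g & f = g * d.

(* Main.v *)
Require Import Defs.
From HB Require Import structures.
From mathcomp Require Import all_boot all_order all_algebra all_field.
From mathcomp Require Import zify ring.

Set Implicit Arguments.
Unset Strict Implicit.
Unset Printing Implicit Defensive.

Import Order.TTheory GRing.Theory Num.Theory.
Local Open Scope ring_scope.

(* Write the first-column hook lengths of a partition with L = t M rows, empty
   rows included, as a beta-set B of L natural numbers.  The partition is a
   t-core iff B is closed under subtracting t, so B then consists, for each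
   residue i, of the numbers i + t q with q < n_i + M, where n = phi_2.  Hence
   phi_2 is injective on t-cores, and its image is given by the size formula.

   For (t, d) = (5, 4), (7, 5), (11, 6) there are exactly t t-cores of size d,
   one for each crank, and their images under phi_2 form an affine Z-basis of
   the vectors n with sum 0 and b.n = d mod t, which contain the images of all
   t-cores of size d mod t.  The Gram matrix of this basis, ordered by crank, is
   circulant, so that rotating the barycentric coordinates preserves the size
   and shifts the crank by 1.  All the cranks are therefore equally frequent,
   and the crank polynomial is a multiple of 1 + w + ... + w^(t-1) = Phi_t. *)

(** * Beta-sets *)

Section BetaSets.
Local Open Scope nat_scope.

Lemma sorted_geq_nth (s : seq nat) i j :
  sorted geq s -> i <= j -> nth 0 s j <= nth 0 s i.
Proof.
move=> s_sorted le_ij; have [ltj|gej] := ltnP j (size s); last by rewrite nth_default.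
have geq_trans : transitive geq by move=> a b c /= ab bc; apply: leq_trans bc ab.
by apply: (sorted_leq_nth geq_trans leqnn 0 s_sorted) => //; rewrite inE ?(leq_ltn_trans le_ij).
Qed.

(** In a nonincreasing list the entries at least [x] form an initial segment. Positivity of [x]
    keeps the default value 0 of [nth] from counting beyond the end. *)
Lemma ltn_count_geq (s : seq nat) x k : sorted geq s -> 0 < x ->
  (k < count (leq x) s) = (x <= nth 0 s k).
Proof.
move=> + x_gt0; elim: s k => [|y s IHs] k ys_sorted /=.
  by rewrite nth_nil; lia.
have s_sorted := path_sorted ys_sorted.
case: (leqP x y) => [xy|yx] /=; first by case: k => [|k] /=; rewrite ?xy // add1n ltnS IHs.
have -> : (x <= nth 0 (y :: s) k) = false.
  by apply/negbTE; rewrite -ltnNge (leq_ltn_trans _ yx) // (@sorted_geq_nth (y :: s) 0 k).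
have /= := @sorted_geq_nth (y :: s) 0 1 ys_sorted isT.
by have := IHs 0 s_sorted; lia.
Qed.

Definition beta (L : nat) (la : seq nat) : seq nat :=
  mkseq (fun k => nth 0 la k + (L - k.+1)) L.

Lemma size_beta L la : size (beta L la) = L.
Proof. exact: size_mkseq. Qed.

Lemma nth_beta L la k : k < L -> nth 0 (beta L la) k = nth 0 la k + (L - k.+1).
Proof. exact: nth_mkseq. Qed.

Lemma mem_betaP L la x :
  reflect (exists2 k, k < L & x = nth 0 la k + (L - k.+1)) (x \in beta L la).
Proof.
apply: (iffP mapP) => -[k]; first by rewrite mem_iota => /andP[_ kL] ->; exists k.
by move=> kL ->; exists k; rewrite ?mem_iota.
Qed.

Lemma beta_sorted L la : sorted geq la -> sorted gtn (beta L la).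
Proof.
move=> la_sorted; apply/(sortedP 0) => i; rewrite size_beta => iL.
rewrite !nth_beta //; last by lia.
by have := sorted_geq_nth la_sorted (leqnSn i); rewrite /gtn /=; lia.
Qed.

(** A strictly decreasing list is determined by its set of members, and removing the staircase gives
    back the parts. As these are positive, the lengths agree too. *)
Lemma beta_inj L la mu :
  is_partition la -> is_partition mu -> size la <= L -> size mu <= L ->
  beta L la =i beta L mu -> la = mu.
Proof.
move=> /andP[la_sorted la0] /andP[mu_sorted mu0] laL muL eq_mem.
have eqb : beta L la = beta L mu.
  apply: (@irr_sorted_eq _ gtn) => //; try exact: beta_sorted.
  - by move=> a b c /=; lia.
  - by move=> a /=; lia.
have eq_nth k : nth 0 la k = nth 0 mu k.
  have [kL|Lk] := ltnP k L; last by rewrite !nth_default //; lia.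
  by have := congr1 (nth 0 ^~ k) eqb; rewrite /= !nth_beta //; lia.
have nz (s : seq nat) k : 0 \notin s -> (0 < nth 0 s k) = (k < size s).
  move=> s0; have [ks|sk] := ltnP k (size s); last by rewrite nth_default.
  by rewrite lt0n; apply: contra s0 => /eqP <-; exact: mem_nth.
apply: (@eq_from_nth _ 0) => //.
have := nz _ (size mu) la0; have := nz _ (size la) mu0.
by rewrite -eq_nth [nth 0 la (size mu)]eq_nth !nth_default // !ltnn; lia.
Qed.

(** Subtracting the staircase from a strictly decreasing list leaves a nonincreasing one; its zeros
    are then dropped. *)
Lemma exists_partition_beta (B : seq nat) : sorted gtn B ->
  exists la, [/\ is_partition la, size la <= size B & beta (size B) la = B].
Proof.
move=> B_sorted; set L := size B.
have gap i j : i <= j -> j < L -> nth 0 B j + (j - i) <= nth 0 B i.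
  move=> ij; rewrite -(subnKC ij); elim: (j - i) => [|d IHd] dL; first by rewrite addn0 subnn addn0.
  have := IHd ltac:(lia); have /(sortedP 0)/(_ (i + d)) := B_sorted.
  by rewrite -/L /gtn /= addnS => /(_ ltac:(lia)); lia.
pose f k := nth 0 B k - (L - k.+1).
pose la := [seq x <- mkseq f L | x != 0].
have f_dec i j : i <= j -> j < L -> f j <= f i.
  by move=> ij jL; have := gap _ _ ij jL; rewrite /f; lia.
(* The zeros of a nonincreasing list are at its end, so dropping them does not change [nth], whose
   default is 0. *)
have la_nth k : nth 0 la k = if k < L then f k else 0.
  have mk_sorted : sorted geq (mkseq f L).
    by apply/(sortedP 0) => i; rewrite size_mkseq => iL; rewrite !nth_mkseq //; [apply: f_dec|lia].
  rewrite -[RHS](_ : nth 0 (mkseq f L) k = _); last first.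
    by case: ltnP => kL; [rewrite nth_mkseq|rewrite nth_default ?size_mkseq].
  rewrite /la; elim: (mkseq f L) k mk_sorted => //= y s IHs k ys.
  case: eqVneq => [y0|_] /=; last by case: k => //= k; rewrite IHs ?(path_sorted ys).
  have s0 i : nth 0 s i = 0.
    by apply/eqP; rewrite -leqn0 -{2}y0; exact: (@sorted_geq_nth (y :: s) 0 i.+1).
  by rewrite IHs ?(path_sorted ys) // s0; case: k => [|k] /=; rewrite ?y0 ?s0.
exists la; split.
- rewrite /is_partition mem_filter eqxx /= andbT.
  apply: sorted_filter; first by move=> a b c /=; lia.
  by apply/(sortedP 0) => i; rewrite size_mkseq => iL; rewrite !nth_mkseq //; [apply: f_dec|lia].
- by rewrite size_filter (leq_trans (count_size _ _)) // size_mkseq.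
apply: (@eq_from_nth _ 0) => [|k]; rewrite size_beta // => kL.
rewrite nth_beta // la_nth kL /f.
(* Comparison with the last entry shows that the truncated subtraction in [f] is exact. *)
by have := gap k L.-1 ltac:(lia) ltac:(lia); lia.
Qed.

Lemma sumn_beta L la : size la <= L -> sumn (beta L la) = sumn la + 'C(L, 2).
Proof.
move=> laL; rewrite /beta sumnE big_map.
rewrite (_ : iota 0 L = index_iota 0 L); last by rewrite /index_iota subn0.
rewrite big_split /= [X in _ + X]big_nat_rev /=.
rewrite -bin2_sum; congr (_ + _); last first.
  by apply: eq_big_nat => i; lia.
rewrite sumnE [RHS](big_nth 0) [LHS](big_cat_nat (leq0n _) laL) /= [X in _ + X]big1_seq ?addn0 // => i.
by rewrite mem_index_iota => /andP[_ /andP[lai _]]; rewrite nth_default.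
Qed.

End BetaSets.

(** * Cores *)

Section Cores.
Local Open Scope nat_scope.

(** The columns of the diagram label the complement of the beta-set, as the rows label its members.
    The subtraction is exact when [la] has at most [L] parts. *)
Definition gap (L : nat) (la : seq nat) (j : nat) : nat :=
  L + j.-1 - conj_part la j.

Lemma ltn_conj_part la j k : sorted geq la -> 0 < j ->
  (k < conj_part la j) = (j <= nth 0 la k).
Proof. exact: ltn_count_geq. Qed.

Lemma conj_part_size la j : conj_part la j <= size la.
Proof. exact: count_size. Qed.

(** Rows of length at least [j] have beta-numbers above the gap, and shorter rows have beta-numbers
    below it. *)
Lemma gap_notin L la j : sorted geq la -> size la <= L -> 0 < j ->
  gap L la j \notin beta L la.
Proof.
move=> la_sorted laL j_gt0; apply/mem_betaP => -[k kL].
have := ltn_conj_part k la_sorted j_gt0; have := conj_part_size la j.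
by rewrite /gap; lia.
Qed.

Lemma exists_gap L la x : sorted geq la -> size la <= L ->
  x \notin beta L la -> exists2 j, 0 < j & gap L la j = x.
Proof.
move=> la_sorted laL xB.
have B_sorted : sorted geq (beta L la).
  by apply: sub_sorted (beta_sorted L la_sorted) => a b /=; exact: ltnW.
(* [r] counts the beta-numbers above [x] and has to be the height of column [j]; solving
   [gap L la j = x] with this height gives [j]. *)
pose r := count (leq x.+1) (beta L la); pose j := x.+1 + r - L.
have rL : r <= L by rewrite -(size_beta L la) count_size.
have rE k : k < L -> (k < r) = (x.+1 <= nth 0 la k + (L - k.+1)).
  by move=> kL; rewrite -nth_beta // -ltn_count_geq.
have r_lt : r < L -> nth 0 la r + (L - r.+1) < x.
  move=> ltrL; have := rE r ltrL; rewrite ltnn => /esym/negbT; rewrite -leqNgt.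
  rewrite leq_eqVlt => /orP[/eqP eq_x|//]; case/negP: xB.
  by apply/mem_betaP; exists r.
have j_gt0 : 0 < j by rewrite /j; case: (ltngtP r L) rL r_lt => //; lia.
have := fun k => ltn_conj_part k la_sorted j_gt0.
have := conj_part_size la j.
set r' := conj_part la j => r'L conjE.
suff eq_r : r' = r by exists j => //; rewrite /gap -/r' eq_r /j; lia.
apply/eqP; rewrite eqn_leq; apply/andP; split; rewrite leqNgt; apply/negP.
  move=> ltr; have := conjE r; have := r_lt; rewrite ltr /j; lia.
move=> ltr; have := conjE r.-1; have := rE r.-1.
by move: j_gt0; rewrite /j; lia.
Qed.

(** A hook leads from the beta-number of its row down to the gap of its column; [L] cancels. *)
Lemma hook_gap L la k j : sorted geq la -> size la <= L -> 0 < j ->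
    j <= nth 0 la k ->
  hook la k.+1 j = ((nth 0%N la k + (L - k.+1))%N%:Z - (gap L la j)%:Z)%R.
Proof.
move=> la_sorted laL j_gt0 jk.
have := ltn_conj_part k la_sorted j_gt0; have := conj_part_size la j.
by rewrite /hook /gap /part jk /=; lia.
Qed.

(** By [hook_gap], a hook length divisible by [t] amounts to a member of the beta-set and a smaller
    non-member congruent to it modulo [t]. Between them, some single step down by [t] already leaves
    the set. *)
Lemma coreP t L la : 0 < t -> is_partition la -> size la <= L ->
  reflect (forall x, x + t \in beta L la -> x \in beta L la) (is_core t la).
Proof.
move=> t_gt0 /andP[la_sorted _] laL.
have row k j : k < size la -> 0 < j <= nth 0 la k -> (t %| hook la k.+1 j)%Z ->
    exists m, nth 0 la k + (L - k.+1) = gap L la j + m * t.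
  move=> kla /andP[j_gt0 jk]; rewrite (hook_gap la_sorted laL) //.
  move=> /dvdzP[m]; have := ltn_conj_part k la_sorted j_gt0.
  have := conj_part_size la j; rewrite jk => conj_le conj_gt eq_m.
  have m_ge0 : (0 <= m)%R.
    have : (0 <= m * t%:Z)%R by move: eq_m; rewrite /gap; lia.
    by rewrite pmulr_lge0 // ltz_nat.
  by exists `|m|; move: eq_m; rewrite -{1}(gez0_abs m_ge0) -PoszM; lia.
apply: (iffP idP) => [core x xtB|closed].
  apply: contraLR core => xB.
  have [j j_gt0 gapj] := exists_gap la_sorted laL xB.
  have /mem_betaP[k kL xtE] := xtB.
  have conjE := ltn_conj_part k la_sorted j_gt0.
  have conjL := conj_part_size la j.
  have jk : j <= nth 0 la k.
    by rewrite -conjE ltnNge; apply/negP => conj_le; move: gapj; rewrite /gap; lia.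
  have kla : k < size la by have := conjE; rewrite jk; lia.
  apply/allPn; exists k.+1; first by rewrite mem_iota; lia.
  apply/allPn; exists j; first by rewrite mem_iota /part /=; lia.
  rewrite negbK (hook_gap la_sorted laL) // gapj -xtE.
  by apply/dvdzP; exists 1%R; lia.
apply/allP => -[|k]; rewrite mem_iota // => k_la.
apply/allP => j; rewrite mem_iota /part /= => j_la.
apply/negP => /row[||m eq_m]; [lia|lia|].
have : gap L la j + m * t \in beta L la by apply/mem_betaP; exists k; [lia|].
elim: m {eq_m} => [|m IHm]; last by rewrite mulSn addnCA addnC => /closed.
by rewrite addn0; apply/negP/gap_notin => //; lia.
Qed.

Lemma core_beta_down t L la i p q : 0 < t -> is_partition la -> size la <= L ->
  is_core t la -> q <= p -> i + t * p \in beta L la -> i + t * q \in beta L la.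
Proof.
move=> t_gt0 la_part laL /(coreP t_gt0 la_part laL) closed qp.
rewrite -(subnKC qp); elim: (p - q) => [|d IHd]; first by rewrite addn0.
by rewrite addnS mulnS addnCA addnC => /closed.
Qed.

Lemma bigmax_seq_attained (r : seq nat) (P : pred nat) (F : nat -> int) x0 :
  let m := \big[Num.max/x0]_(k <- r | P k) F k in
  m = x0 \/ exists2 k, (k \in r) && P k & F k = m.
Proof.
rewrite /=; elim: r => [|k r IHr]; first by left; rewrite big_nil.
rewrite big_cons; case: ifP => Pk; last first.
  by case: IHr => [|[l /andP[lr Pl] Fl]]; [left|right; exists l; rewrite ?inE ?lr ?orbT].
have [_|_] := leP.
  by case: IHr => [|[l /andP[lr Pl] Fl]]; [left|right; exists l; rewrite ?inE ?lr ?orbT].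
by right; exists k; rewrite // inE eqxx.
Qed.

End Cores.

(** * Reading [phi2] off the beta-set *)

Lemma end_diff_beta L la k : (k < L)%N ->
  end_diff la k.+1 = (nth 0%N la k + (L - k.+1))%:Z - L%:Z.
Proof. by rewrite /end_diff /part /=; lia. Qed.

Lemma end_region_beta t M la k : (0 < t)%N -> (k < t * M)%N ->
  end_region t la k.+1 =
    ((nth 0%N la k + (t * M - k.+1)) %/ t)%N%:Z + 1 - M%:Z.
Proof.
move=> t_gt0 kL; rewrite /end_region (end_diff_beta _ kL) PoszM [_%:Z * _]mulrC.
by rewrite -mulNr [_ + _ * _]addrC divzMDl ?divz_nat; lia.
Qed.

Lemma end_color_beta t M la k : (0 < t)%N -> (k < t * M)%N ->
  (end_diff la k.+1 %% t%:Z)%Z =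
    ((nth 0%N la k + (t * M - k.+1)) %% t)%N%:Z.
Proof.
move=> t_gt0 kL; rewrite (end_diff_beta _ kL) PoszM [_%:Z * _]mulrC.
by rewrite -mulNr addrC modzMDl modz_nat.
Qed.

Lemma end_region_noninc t la k l : (0 < t)%N -> sorted geq la -> (k <= l)%N ->
  end_region t la l.+1 <= end_region t la k.+1.
Proof.
move=> t_gt0 la_sorted kl; have := sorted_geq_nth la_sorted kl => le_nth.
rewrite /end_region lerD2r lez_pdiv2r //.
by rewrite /end_diff /part /=; lia.
Qed.

(** A row of colour [i] and region [r] has beta-number [i + t * (r + M - 1)], so the largest region
    marks the largest member of residue [i]. In a core all smaller numbers of that residue are
    members too. *)
Lemma mem_beta_core t M la (i : 'I_t) q :
    is_partition la -> is_core t la -> (size la + t <= t * M)%N ->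
  (i + t * q \in beta (t * M) la)%N = (q%:Z < phi2 t la 0 i + M%:Z).
Proof.
move=> la_part la_core laM; have /andP[la_sorted _] := la_part.
have t_gt0 : (0 < t)%N by case: t i {la_core laM} => [[]|].
have laL : (size la <= t * M)%N by lia.
rewrite mxE; set m := \big[Num.max/_]_(1 <= k < _ | _) _.
have noninc := end_region_noninc t_gt0 la_sorted.
have := bigmax_seq_attained (index_iota 1 (size la + t).+1)
  (fun k => (end_diff la k %% t)%Z == i%:Z) (end_region t la)
  (end_region t la (size la + t)).
rewrite /= -/m => attained.
(* Rows beyond [size la + t] do not enter the maximum, but their regions are at most the seed. *)
have m_ge k : (k < t * M)%N -> (end_diff la k.+1 %% t)%Z == i%:Z ->
    end_region t la k.+1 <= m.
  move=> kL ki; have [k_lt|k_ge] := ltnP k (size la + t).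
    by apply: le_bigmax_seq; rewrite // mem_index_iota; lia.
  apply: le_trans (bigmax_ge_id _ _ _ _).
  by rewrite -(prednK (_ : 0 < size la + t)%N); [apply: noninc|]; lia.
have [k0 [k0_ge k0_lt k0_i]] : exists k, [/\ (size la <= k)%N,
    (k < size la + t)%N & (end_diff la k.+1 %% t)%Z == i%:Z].
  (* The first empty row has beta-number [X] and the following ones descend by 1, so residue [i]
     occurs [d] rows later. Adding [t] avoids truncation. *)
  pose X := (t * M - (size la).+1)%N; pose d := ((X + t - i) %% t)%N.
  have d_lt : (d < t)%N by rewrite ltn_pmod.
  exists (size la + d)%N; split; [lia|lia|].
  rewrite (@end_color_beta t M) //; last by lia.
  rewrite nth_default ?leq_addr // add0n.
  have := divn_eq (X + t - i) t; rewrite -/d => X_eq.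
  have i_lt := ltn_ord i.
  have Q_gt0 : (0 < (X + t - i) %/ t)%N by rewrite divn_gt0 // /X; lia.
  have -> : (t * M - (size la + d).+1)%N = (((X + t - i) %/ t).-1 * t + i)%N.
    by rewrite -subn1 mulnBl mul1n; move: X_eq; rewrite /X; nia.
  by rewrite modnMDl modn_small.
have [k [k_lt ki km]] : exists k, [/\ (k < size la + t)%N,
    (end_diff la k.+1 %% t)%Z == i%:Z & end_region t la k.+1 = m].
  case: attained => [m_eq|[[|k] /andP[]]]; last 2 first.
  - by rewrite mem_index_iota.
  - by rewrite mem_index_iota => k_lt ki km; exists k; split=> //; lia.
  (* When the maximum is the seed, the empty row [k0] of colour [i] attains it. *)
  exists k0; split=> //; apply/eqP; rewrite eq_le m_ge //=; last by lia.
  by rewrite m_eq -(prednK (_ : 0 < size la + t)%N); [apply: noninc|]; lia.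
apply/mem_betaP/idP => [[l lL xE]|].
  have := m_ge l lL; rewrite (end_color_beta _ t_gt0 lL) (end_region_beta _ t_gt0 lL) -xE.
  rewrite mulnC addnC divnMDl // modnMDl divn_small // modn_small // eqxx => /(_ isT).
  by lia.
have kL : (k < t * M)%N by lia.
have := km; rewrite (end_region_beta _ t_gt0 kL) => <- q_lt.
apply/mem_betaP.
set x := (nth 0%N la k + (t * M - k.+1))%N in q_lt.
have xB : x \in beta (t * M) la by apply/mem_betaP; exists k.
have xE : x = (i + t * (x %/ t))%N.
  rewrite {1}(divn_eq x t) addnC mulnC; congr (_ + _)%N.
  by move: ki; rewrite (end_color_beta _ t_gt0 kL) -/x => /eqP; lia.
rewrite xE in xB; apply: core_beta_down xB => //; lia.
Qed.

(** * The image of [phi2] *)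

(** The size formula is doubled to stay within the integers. *)
Definition core_vector (t N : nat) (v : 'rV[int]_t) : bool :=
  (\sum_i v 0 i == 0) &&
  (t%:Z * (\sum_i v 0 i ^+ 2) + 2 * (\sum_(i < t) i%:Z * v 0 i) == 2 * N%:Z).

Section Runs.
Local Open Scope nat_scope.

(** The shape of the beta-set of a core: an initial stretch of length [a i] in each residue
    class. *)
Definition runs t (a : 'I_t -> nat) : seq nat :=
  [seq i + t * q | i : 'I_t <- index_enum 'I_t, q : nat <- iota 0 (a i)].

Lemma runs_coord_inj t (i j : 'I_t) p q :
  i + t * p = j + t * q -> i = j /\ p = q.
Proof.
move=> eq_ij; have t_gt0 : 0 < t by apply: leq_ltn_trans (ltn_ord i).
have := congr1 (modn^~ t) eq_ij.
rewrite !(addnC (nat_of_ord _)) !(mulnC t) !modnMDl !modn_small // => /val_inj eq_i.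
move: eq_ij; rewrite eq_i => /addnI/eqP; rewrite eqn_pmul2l // => /eqP.
by split.
Qed.

Lemma mem_runs t (a : 'I_t -> nat) (i : 'I_t) q : (i + t * q \in runs a) = (q < a i).
Proof.
apply/allpairsPdep/idP => [[j [p [_ + /runs_coord_inj[-> ->]]]]|q_lt].
  by rewrite mem_iota.
by exists i, q; rewrite mem_index_enum mem_iota.
Qed.

Lemma runs_uniq t (a : 'I_t -> nat) : uniq (runs a).
Proof.
apply: allpairs_uniq_dep; first exact: index_enum_uniq.
  by move=> *; exact: iota_uniq.
by move=> [i p] [j q] _ _ /= /runs_coord_inj[-> ->].
Qed.

Lemma size_runs t (a : 'I_t -> nat) : size (runs a) = \sum_i a i.
Proof.
rewrite size_allpairs_dep sumnE big_map.
by apply: eq_bigr => i _; rewrite size_iota.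
Qed.

Lemma sumn_runs t (a : 'I_t -> nat) : sumn (runs a) = \sum_(i < t) (i * a i + t * 'C(a i, 2)).
Proof.
rewrite sumnE big_allpairs_dep; apply: eq_bigr => i _.
rewrite (_ : iota 0 (a i) = index_iota 0 (a i)); last by rewrite /index_iota subn0.
by rewrite big_split sum_nat_const_nat subn0 mulnC -big_distrr -bin2_sum.
Qed.

Lemma coord_ind t (P : nat -> Prop) : 0 < t ->
  (forall (i : 'I_t) q, P (i + t * q)) -> forall x, P x.
Proof.
move=> t_gt0 allP x; have := allP (Ordinal (ltn_pmod x t_gt0)) (x %/ t).
by rewrite /= addnC mulnC -divn_eq.
Qed.

End Runs.

Lemma Posz_sum (I : Type) (r : seq I) (P : pred I) (F : I -> nat) :
  (\sum_(i <- r | P i) F i)%N%:Z = \sum_(i <- r | P i) (F i)%:Z.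
Proof. exact: (big_morph Posz PoszD (erefl _)). Qed.

Lemma bin2_int (n : nat) : 2 * 'C(n, 2)%:Z = n%:Z * (n%:Z - 1).
Proof.
have := bin_ffact n 2; rewrite ffactnS ffactn1 (_ : 2`! = 2)%N //.
by case: n => [|n] /=; nia.
Qed.

(** The count of the numbers exceeds [t * M] by the sum of [v]. Twice their total is the doubled
    size formula, plus a multiple of the sum of [v], plus [t * M * (t * M - 1)], which is the
    contribution of the staircase. *)
Lemma runs_core_vector t M N (v : 'rV[int]_t) : (forall i, 0 <= v 0 i + M%:Z) ->
  let a i := `|(v 0 i + M%:Z)%R|%N in
  (size (runs a) == t * M)%N && (sumn (runs a) == N + 'C(t * M, 2))%N =
  core_vector N v.
Proof.
move=> v_ge a; have aE i : (a i)%:Z = v 0 i + M%:Z by rewrite gez0_abs.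
have sizeE : (size (runs a))%:Z = \sum_i v 0 i + t%:Z * M%:Z.
  rewrite size_runs Posz_sum (eq_bigr _ (fun i _ => aE i)).
  by rewrite big_split /= sumr_const card_ord -mulr_natl natz.
have idE : 2 * (\sum_(i < t) i%:Z) = t%:Z * (t%:Z - 1).
  by rewrite -bin2_int -bin2_sum big_mkord Posz_sum.
have sumE : 2 * (sumn (runs a))%:Z =
    t%:Z * (\sum_i v 0 i ^+ 2) + 2 * (\sum_(i < t) i%:Z * v 0 i)
    + (2 * M%:Z - 1) * t%:Z * (\sum_i v 0 i)
    + t%:Z * M%:Z * (t%:Z * M%:Z - 1).
  rewrite sumn_runs Posz_sum [LHS]mulr_sumr.
  transitivity (\sum_(i < t) (t%:Z * v 0 i ^+ 2 + 2 * (i%:Z * v 0 i)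
      + (2 * M%:Z - 1) * t%:Z * v 0 i + M%:Z * (2 * i%:Z)
      + t%:Z * M%:Z * (M%:Z - 1))).
    apply: eq_bigr => i _; rewrite PoszD !PoszM mulrDr [2 * (t%:Z * _)]mulrCA bin2_int aE.
    ring.
  rewrite !big_split /= -!mulr_sumr idE sumr_const card_ord -mulr_natl natz.
  ring.
rewrite /core_vector.
have -> : (size (runs a) == t * M)%N = (\sum_i v 0 i == 0).
  by rewrite -eqz_nat sizeE PoszM -subr_eq0 addrK.
case: eqP => //= sum0.
have -> : (sumn (runs a) == N + 'C(t * M, 2))%N
    = (2 * (sumn (runs a))%:Z == 2 * N%:Z + 2 * 'C(t * M, 2)%:Z).
  by apply/eqP/eqP; lia.
by rewrite sumE sum0 bin2_int PoszM mulr0 addr0 (inj_eq (addIr _)).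
Qed.

Lemma size_le_sumn la : is_partition la -> (size la <= sumn la)%N.
Proof.
move=> /andP[_]; elim: la => //= x la IHla; rewrite inE negb_or => /andP[x0 /IHla].
by lia.
Qed.

(** The beta-numbers are counted and summed in two ways, by rows and by residue classes. *)
Lemma core_vector_phi2 t la : (0 < t)%N -> is_partition la -> is_core t la ->
  core_vector (sumn la) (phi2 t la).
Proof.
move=> t_gt0 la_part la_core; have /andP[la_sorted _] := la_part.
pose M := (size la + t)%N.
have LM : (size la + t <= t * M)%N by rewrite /M; nia.
(* The seed of the maximum comes from an empty row with [end_diff] equal to [- M], which bounds
   every coordinate from below. *)
have v_ge i : 0 <= phi2 t la 0 i + M%:Z.
  have : end_region t la M <= phi2 t la 0 i by rewrite mxE bigmax_ge_id.
  rewrite /end_region /end_diff /part nth_default /M; last by lia.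
  have : - M%:Z <= ((- M%:Z) %/ t%:Z)%Z by rewrite lez_divRL // /M; nia.
  by rewrite sub0r /M; lia.
rewrite -(@runs_core_vector _ M) //; set a := (X in runs X).
have eq_mem : beta (t * M) la =i runs a.
  apply: (coord_ind t_gt0) => i q.
  by rewrite mem_beta_core // mem_runs /a -ltz_nat gez0_abs.
have Bperm : perm_eq (beta (t * M) la) (runs a).
  apply: uniq_perm => //; last exact: runs_uniq.
  apply: (@sorted_uniq _ gtn); last exact: beta_sorted.
    by move=> x y z /=; lia.
  by move=> x /=; lia.
rewrite -(perm_size Bperm) -(perm_sumn Bperm) size_beta sumn_beta ?eqxx //.
by lia.
Qed.

Lemma phi2_inj t la mu : (0 < t)%N ->
    is_partition la -> is_partition mu -> is_core t la -> is_core t mu ->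
  phi2 t la = phi2 t mu -> la = mu.
Proof.
move=> t_gt0 la_part mu_part la_core mu_core eq_phi.
pose M := (size la + size mu + t)%N.
have laM : (size la + t <= t * M)%N by rewrite /M; nia.
have muM : (size mu + t <= t * M)%N by rewrite /M; nia.
apply: (@beta_inj (t * M)) => //.
- exact: leq_trans (leq_addr _ _) laM.
- exact: leq_trans (leq_addr _ _) muM.
by apply: (coord_ind t_gt0) => i q; rewrite !mem_beta_core // eq_phi.
Qed.

Lemma phi2_surj t N (v : 'rV[int]_t) : (0 < t)%N -> core_vector N v ->
  exists la, [/\ is_partition la, is_core t la, sumn la = N & phi2 t la = v].
Proof.
(* The terms [N + t] leave room for [t] empty rows below a partition of [N]; the others make every
   run nonempty. *)
move=> t_gt0 v_core; pose M := (N + t + \sum_i `|(v 0 i)%R| + 1)%N.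
have v_gt i : 0 < v 0 i + M%:Z.
  by rewrite /M (bigD1 i) //=; lia.
have := @runs_core_vector t M N v (fun i => ltW (v_gt i)).
rewrite /= v_core; set a := (X in runs X) => /andP[/eqP size_a /eqP sum_a].
have aE i : (a i)%:Z = v 0 i + M%:Z by rewrite gez0_abs // ltW.
pose B := sort geq (runs a).
have memB : B =i runs a by exact: mem_sort.
have B_sorted : sorted gtn B.
  rewrite gtn_sorted_uniq_geq sort_uniq runs_uniq /=.
  by apply: sort_sorted => x y; exact: leq_total y x.
have [la []] := exists_partition_beta B_sorted.
rewrite size_sort size_a => la_part laL betaE; exists la.
have sum_la : sumn la = N.
  apply/eqP; rewrite -(eqn_add2r 'C(t * M, 2)) -sumn_beta // betaE -sum_a.
  by apply/eqP/perm_sumn; rewrite perm_sort.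
have la_core : is_core t la.
  apply/(coreP t_gt0 la_part laL).
  apply: (coord_ind t_gt0) => i q.
  by rewrite -addnA -mulnSr betaE !memB !mem_runs; lia.
split=> //; apply/rowP => i.
have laM : (size la + t <= t * M)%N.
  by have := size_le_sumn la_part; rewrite sum_la /M; nia.
have mem_a q : (q < a i)%N = (q%:Z < phi2 t la 0 i + M%:Z).
  by rewrite -mem_beta_core // betaE memB mem_runs.
(* Membership at the end of the run and just before it pins down the coordinate. *)
have := aE i; have := v_gt i; have := mem_a (a i); have := mem_a (a i).-1.
by lia.
Qed.

(** * Equidistribution of the crank *)

Definition vector_crank (t : nat) (v : 'rV[int]_t) : int :=
  \sum_(i < t) (crank_weights t)`_i * v 0 i.

(** A relation replaces an injective map because images are obtained below only through existence
    statements; finiteness provides the choice. *)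
Lemma leq_card_rel (T : finType) (A B : {set T}) (R : T -> T -> Prop) :
    (forall x, x \in A -> exists2 y, y \in B & R x y) ->
    (forall x x' y, x \in A -> x' \in A -> R x y -> R x' y -> x = x') ->
  (#|A| <= #|B|)%N.
Proof.
move=> R_total R_inj.
have [f fP] : exists f : T -> T, forall x, x \in A -> f x \in B /\ R x (f x).
  apply: (@fin_all_exists _ (fun=> T) (fun x y => x \in A -> y \in B /\ R x y)) => x.
  have [xA|xA] := boolP (x \in A); last by exists x.
  by have [y yB Rxy] := R_total x xA; exists y.
have f_inj : {in A &, injective f}.
  move=> x y xA yA eq_f; apply: (R_inj _ _ (f x)) => //; first by case: (fP x xA).
  by rewrite eq_f; case: (fP y yA).
rewrite -(card_in_imset f_inj); apply/subset_leq_card/subsetP => _ /imsetP[x xA ->].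
by case: (fP x xA).
Qed.

Lemma core_count_le t N m m' (R : 'rV[int]_t -> 'rV[int]_t -> Prop) :
    (0 < t)%N ->
    (forall v, core_vector N v -> (vector_crank v %% t)%Z = m%:Z ->
      exists w, [/\ core_vector N w, (vector_crank w %% t)%Z = m'%:Z & R v w]) ->
    (forall v v' w, R v w -> R v' w -> v = v') ->
  (core_count t m N <= core_count t m' N)%N.
Proof.
move=> t_gt0 R_total R_inj.
pose parts (s : {bseq N of 'I_N.+1}) := [seq val x | x <- s].
apply: (@leq_card_rel _ _ _ (fun s s' => R (phi2 t (parts s)) (phi2 t (parts s')))).
  move=> s; rewrite inE -/(parts s) => /and4P[la_part /eqP sum_la la_core /eqP la_crank].
  have v_core := core_vector_phi2 t_gt0 la_part la_core; rewrite sum_la in v_core.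
  have [w [w_core w_crank Rvw]] := R_total _ v_core la_crank.
  have [mu [mu_part mu_core sum_mu phi_mu]] := phi2_surj t_gt0 w_core.
  (* A partition of [N] has at most [N] parts, each at most [N], so it fits the finite type being
     counted. *)
  have mu_size : (size [seq (inord x : 'I_N.+1) | x <- mu] <= N)%N.
    by rewrite size_map -sum_mu size_le_sumn.
  have partsK : parts (Bseq mu_size) = mu.
    rewrite /parts /= -map_comp map_id_in // => x x_mu /=; rewrite inordK // ltnS -sum_mu.
    by elim: (mu) x_mu => //= y mu' IHmu; rewrite inE => /predU1P[->|/IHmu]; lia.
  exists (Bseq mu_size); last by rewrite partsK phi_mu.
  rewrite inE -/(parts (Bseq mu_size)) partsK /= mu_part sum_mu eqxx mu_core /core_crank phi_mu.
  exact/eqP.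
move=> s s' s''; rewrite !inE -/(parts s) -/(parts s').
move=> /and4P[s_part _ s_core _] /and4P[s'_part _ s'_core _] /R_inj H /H eq_phi.
by apply/val_inj/(inj_map val_inj)/(phi2_inj t_gt0 s_part s'_part).
Qed.

(** * Vectors as lists, and affine frames *)

Definition row_of (t : nat) (x : seq int) : 'rV[int]_t := \row_(i < t) x`_i.

Lemma row_of_onto t (v : 'rV[int]_t) : exists2 x, size x = t & v = row_of t x.
Proof.
exists [seq v 0 i | i <- enum 'I_t]; first by rewrite size_map size_enum_ord.
by apply/rowP => i; rewrite mxE (nth_map i) ?size_enum_ord // nth_ord_enum.
Qed.

Lemma row_of_inj t (x y : seq int) : size x = t -> size y = t ->
  row_of t x = row_of t y -> x = y.
Proof.
move=> size_x size_y eq_xy; apply: (@eq_from_nth _ 0); first by rewrite size_y.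
by move=> k; rewrite size_x => kt; have /rowP/(_ (Ordinal kt)) := eq_xy; rewrite !mxE.
Qed.

(** Twice the size formula, on lists, so that on an explicit frame it unfolds to a polynomial in
    named entries. *)
Definition size_form (t : nat) (x : seq int) : int :=
  t%:Z * (\sum_(0 <= k < t) x`_k ^+ 2) + 2 * (\sum_(0 <= k < t) k%:Z * x`_k).

Lemma core_vector_row_of t N x : core_vector N (row_of t x) =
  (\sum_(0 <= k < t) x`_k == 0) && (size_form t x == 2 * N%:Z).
Proof.
have rowE (F : nat -> int -> int) :
    \sum_(i < t) F i (row_of t x 0 i) = \sum_(0 <= k < t) F k x`_k.
  by rewrite big_mkord; apply: eq_bigr => i _; rewrite mxE.
by rewrite /core_vector (rowE (fun=> id)) (rowE (fun _ y => y ^+ 2)) (rowE (fun k => *%R k%:Z)).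
Qed.

Definition seq_crank (t : nat) (x : seq int) : int :=
  \sum_(0 <= k < t) (crank_weights t)`_k * x`_k.

Lemma vector_crank_row_of t x : vector_crank (row_of t x) = seq_crank t x.
Proof. by rewrite /seq_crank big_mkord; apply: eq_bigr => i _; rewrite mxE. Qed.

(* [frame a] is meant to be the affine combination, with coefficients [a], of
   the images under [phi2] of the [t]-cores of size [d], the [k]-th of which has
   crank [k]. *)
Record crank_frame (t d : nat) (frame : seq int -> seq int) : Prop := {
  frame_size a : size (frame a) = t;
  frame_onto x : size x = t -> \sum_(0 <= k < t) x`_k = 0 ->
    (t %| \sum_(0 <= k < t) k%:Z * x`_k - d%:Z)%Z ->
    exists a, [/\ size a = t, \sum_(c <- a) c = 1 & x = frame a];
  frame_inj a b : size a = t -> size b = t -> \sum_(c <- a) c = 1 ->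
    \sum_(c <- b) c = 1 -> frame a = frame b -> a = b;
  frame_sum a : size a = t -> \sum_(0 <= k < t) (frame a)`_k = 0;
  frame_size_form a : size a = t -> \sum_(c <- a) c = 1 ->
    size_form t (frame (rot 1 a)) = size_form t (frame a);
  frame_crank a : size a = t -> \sum_(c <- a) c = 1 ->
    (seq_crank t (frame a) = seq_crank t (frame (rot 1 a)) + 1 %[mod t])%Z
}.

(** A square has the parity of its root, so the squared norm is even when the entries sum to 0. Half
    of it is then an integer, and the size formula can be read modulo [t]. *)
Lemma core_vector_mod t n d (v : 'rV[int]_t) : core_vector (t * n + d) v ->
  (t %| \sum_(i < t) i%:Z * v 0 i - d%:Z)%Z.
Proof.
move=> /andP[/eqP sum0 /eqP sizeE].
have /dvdzP[y yE] : (2 %| \sum_i v 0 i ^+ 2)%Z.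
  have -> : \sum_i v 0 i ^+ 2 = \sum_i v 0 i * (v 0 i - 1).
    transitivity (\sum_i v 0 i ^+ 2 - \sum_i v 0 i); first by rewrite sum0 subr0.
    by rewrite -sumrB; apply: eq_bigr => i _; ring.
  apply: rpred_sum => i _; set x := v 0 i.
  have [/dvdzP[q ->]|] := boolP (2 %| x)%Z; first by apply: dvdz_mulr; apply: dvdz_mull.
  move=> x_odd; apply: dvdz_mull; lia.
apply/dvdzP; exists (n%:Z - y); move: sizeE; rewrite yE PoszD PoszM.
set S := \sum_(i < t) _; rewrite mulrBl [n%:Z * _]mulrC mulrCA.
by lia.
Qed.

(** Rotating the coefficients is injective, keeps the size and lowers the crank by 1. The counts
    thus satisfy a cycle of inequalities, which forces equality. *)
Lemma core_count_const t d frame n m : crank_frame t d frame -> (m < t)%N ->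
  core_count t m (t * n + d) = core_count t 0 (t * n + d).
Proof.
move=> t_frame m_lt.
set N := (t * n + d)%N; pose c k := core_count t k N.
have t_gt0 : (0 < t)%N by lia.
have step k : (c (k.+1 %% t) <= c (k %% t))%N.
  pose R (v w : 'rV[int]_t) := exists a, [/\ size a = t, \sum_(x <- a) x = 1,
    v = row_of t (frame a) & w = row_of t (frame (rot 1 a))].
  apply: (core_count_le (R := R)) => // [v v_core v_crank|v v' w].
    have v_mod := core_vector_mod v_core.
    have [x size_x vE] := row_of_onto v; move: v_core; rewrite vE core_vector_row_of.
    move=> /andP[/eqP sum_x /eqP form_x].
    have [|a [size_a sum_a xE]] := frame_onto t_frame size_x sum_x.
      by move: v_mod; rewrite vE big_mkord; under eq_bigr => i _ do rewrite mxE.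
    exists (row_of t (frame (rot 1 a))); split; last by exists a; rewrite xE.
      rewrite core_vector_row_of (frame_sum t_frame) ?size_rot // eqxx /=.
      by rewrite (frame_size_form t_frame) // -xE form_x.
    have := frame_crank t_frame size_a sum_a.
    rewrite -xE -!vector_crank_row_of -vE v_crank -modz_nat => /eqP.
    by rewrite -addn1 PoszD eqz_modDr -modz_nat => /eqP.
  move=> [a [size_a sum_a -> ->]] [b [size_b sum_b ->]].
  move=> /row_of_inj; rewrite !(frame_size t_frame) => /(_ erefl erefl) eq_ab.
  have eq_rot : rot 1 a = rot 1 b.
    apply: (frame_inj t_frame); rewrite ?size_rot //.
      by rewrite (perm_big _ (permEl (perm_rot 1 a))).
    by rewrite (perm_big _ (permEl (perm_rot 1 b))).
  by rewrite (rot_inj eq_rot).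
have le0 k : (c (k %% t) <= c 0)%N.
  elim: k => [|k IHk]; first by rewrite mod0n.
  exact: leq_trans (step k) IHk.
have ge k l : (c ((k + l) %% t) <= c (k %% t))%N.
  elim: l => [|l IHl]; first by rewrite addn0.
  by rewrite addnS; apply: leq_trans (step _) IHl.
(* From crank [m], another [t - m] steps close the cycle at crank 0. *)
apply/eqP; rewrite eqn_leq -[m](modn_small m_lt) le0 /=.
by have := ge m (t - m)%N; rewrite subnKC ?modnn // ltnW.
Qed.

(** * Divisibility by cyclotomic polynomials of prime index *)

Lemma Cyclotomic_prime p : prime p -> 'Phi_p = \sum_(i < p) 'X^i.
Proof.
move=> p_pr; have p_gt0 := prime_gt0 p_pr.
have := prod_Cyclotomic p_gt0; have -> : \prod_(d <- divisors p) 'Phi_d = 'Phi_1 * 'Phi_p.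
  rewrite (perm_big [:: 1; p]%N) /=; first by rewrite !big_cons big_nil mulr1.
  apply: uniq_perm (divisors_uniq p) _ _ => [|x].
    by rewrite /= inE andbT; case: p p_pr {p_gt0} => [|[]].
  rewrite -dvdn_divisors // !inE; apply/idP/orP => [|[]/eqP-> //].
  by case/primeP: p_pr => _ /[apply] /orP.
have := prod_Cyclotomic (ltn0Sn 0); rewrite big_seq1 => ->.
rewrite expr1 subrX1 => /mulfI; apply.
by rewrite -polyC1 polyXsubC_eq0.
Qed.

Lemma laurent_dvd_prime p (f : {poly int}) c : prime p ->
  f = \sum_(i < p) c *: 'X^i -> laurent_dvd ('Phi_p)%:F f%:F.
Proof.
move=> p_pr ->; exists (c%:P)%:F.
  by exists c%:P, 0%N; rewrite expr0 tofrac1 divr1.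
rewrite -tofracM (Cyclotomic_prime p_pr) mul_polyC scaler_sumr //.
Qed.

Lemma core_crank_poly_dvd t d frame n : prime t -> crank_frame t d frame ->
  laurent_dvd ('Phi_t)%:F (core_crank_poly t (t * n + d))%:F.
Proof.
move=> t_pr t_frame; apply: (laurent_dvd_prime t_pr).
by apply: eq_bigr => m _; rewrite (core_count_const n t_frame (ltn_ord m)).
Qed.

(** * The three frames *)

(** Hooks of a partition of 4 are shorter than 5, so its five partitions are all 5-cores. The
    coefficients of the entry of index [k] of [a] form the vector of the one with crank [k]; index 0
    gives (1, 1, 0, -1, -1). *)
Definition frame5 (a : seq int) : seq int :=
  [:: a`_0 + a`_3; a`_0 + a`_1 - a`_3; - a`_1 + a`_4; - a`_0 + a`_2 - a`_4;
      - a`_0 - a`_2].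

Lemma frame5P : crank_frame 5 4 frame5.
Proof.
split=> //.
- move=> x size_x; rewrite /index_iota !subn0 /= !big_cons !big_nil /=.
  case: x size_x => [|x0 [|x1 [|x2 [|x3 [|x4 []]]]]] //= _ sum_x.
  case/dvdzP=> z zE.
  (* The barycentric coordinates of [x], made integral by [z]. *)
  exists [:: - z - 1; - x2 - x3 - x4 + 2 * z + 2; - x4 + z + 1; - x1 - x2 - x3 - x4 + z + 1;
      - x3 - x4 + 2 * z + 2].
  split=> //; first by rewrite !big_cons big_nil; lia.
  by congr [:: _; _; _; _; _] => /=; lia.
- move=> a b size_a size_b.
  case: a size_a => [|a0 [|a1 [|a2 [|a3 [|a4 []]]]]] //= _.
  case: b size_b => [|b0 [|b1 [|b2 [|b3 [|b4 []]]]]] //= _.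
  (* The entries of a frame always sum to 0, so comparing them is one equation short; the sums equal
     to 1 supply it. *)
  rewrite !big_cons !big_nil => sum_a sum_b; rewrite /frame5 /=.
  by case=> *; congr [:: _; _; _; _; _]; lia.
- move=> a size_a; rewrite /index_iota !subn0 /= !big_cons !big_nil /=.
  by case: a size_a => [|a0 [|a1 [|a2 [|a3 [|a4 []]]]]] //= _; ring.
- move=> a size_a; rewrite /size_form /index_iota !subn0 /= !big_cons !big_nil /=.
  case: a size_a => [|a0 [|a1 [|a2 [|a3 [|a4 []]]]]] //= _.
  rewrite !big_cons big_nil => sum_a.
  (* The invariance holds only where the coefficients sum to 1; eliminating [a0] turns it into a
     polynomial identity. *)
  have -> : a0 = 1 - (a1 + a2 + a3 + a4) by lia.
  ring.
- move=> a size_a; rewrite /seq_crank /index_iota !subn0 /= !big_cons !big_nil /=.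
  case: a size_a => [|a0 [|a1 [|a2 [|a3 [|a4 []]]]]] //= _.
  rewrite !big_cons big_nil => sum_a.
  (* Modulo 5 the crank is the sum of [k * a_k], so rotation changes it by the sum of the
     coefficients, which is 1. *)
  by lia.
Qed.

(** The vectors of the seven partitions of 5, all of them 7-cores, in order of crank. *)
Definition frame7 (a : seq int) : seq int :=
  [:: a`_1 + a`_3 + a`_6; a`_1 + a`_2; a`_0 - a`_3 + a`_6; - a`_2 + a`_5;
      - a`_0 - a`_1 + a`_4; - a`_5 - a`_6; - a`_1 - a`_4 - a`_6].

Lemma frame7P : crank_frame 7 5 frame7.
Proof.
split=> //.
- move=> x size_x; rewrite /index_iota !subn0 /= !big_cons !big_nil /=.
  case: x size_x => [|x0 [|x1 [|x2 [|x3 [|x4 [|x5 [|x6 []]]]]]]] //= _ sum_x.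
  case/dvdzP=> z zE.
  (* Solving for coefficients of sum 1 produces denominators 7, which [z] absorbs through [zE]. *)
  exists [:: x2 + x3 + x4 + 2 * x5 + 2 * x6 - 2 * z - 1;
      - x2 - x3 - 2 * x4 - 2 * x5 - 3 * x6 + 3 * z + 2;
      x1 + x2 + x3 + 2 * x4 + 2 * x5 + 3 * x6 - 3 * z - 2;
      - x1 - x2 - x3 - x4 - x5 - x6 + z + 1; - x6 + z + 1;
      x1 + x2 + 2 * x3 + 2 * x4 + 2 * x5 + 3 * x6 - 3 * z - 2;
      - x1 - x2 - 2 * x3 - 2 * x4 - 3 * x5 - 3 * x6 + 3 * z + 2].
  split=> //; first by rewrite !big_cons big_nil; lia.
  by congr [:: _; _; _; _; _; _; _] => /=; lia.
- move=> a b size_a size_b.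
  case: a size_a => [|a0 [|a1 [|a2 [|a3 [|a4 [|a5 [|a6 []]]]]]]] //= _.
  case: b size_b => [|b0 [|b1 [|b2 [|b3 [|b4 [|b5 [|b6 []]]]]]]] //= _.
  rewrite !big_cons !big_nil => sum_a sum_b; rewrite /frame7 /=.
  by case=> *; congr [:: _; _; _; _; _; _; _]; lia.
- move=> a size_a; rewrite /index_iota !subn0 /= !big_cons !big_nil /=.
  by case: a size_a => [|a0 [|a1 [|a2 [|a3 [|a4 [|a5 [|a6 []]]]]]]] //= _; ring.
- move=> a size_a; rewrite /size_form /index_iota !subn0 /= !big_cons !big_nil /=.
  case: a size_a => [|a0 [|a1 [|a2 [|a3 [|a4 [|a5 [|a6 []]]]]]]] //= _.
  rewrite !big_cons big_nil => sum_a.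
  have -> : a0 = 1 - (a1 + a2 + a3 + a4 + a5 + a6) by lia.
  ring.
- move=> a size_a; rewrite /seq_crank /index_iota !subn0 /= !big_cons !big_nil /=.
  case: a size_a => [|a0 [|a1 [|a2 [|a3 [|a4 [|a5 [|a6 []]]]]]]] //= _.
  rewrite !big_cons big_nil => sum_a.
  by lia.
Qed.

(** The vectors of the eleven partitions of 6, all of them 11-cores, in order of crank. *)
Definition frame11 (a : seq int) : seq int :=
  [:: a`_0 + a`_4 + a`_5 + a`_6 + a`_10; a`_1 + a`_6 + a`_8 + a`_10;
      a`_0 + a`_1 + a`_2; a`_5 + a`_9; a`_3; - a`_4 + a`_7; - a`_8; - a`_2 - a`_6;
      - a`_0 - a`_9 - a`_10; - a`_1 - a`_3 - a`_5 - a`_10;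
      - a`_0 - a`_1 - a`_5 - a`_6 - a`_7].

Lemma frame11P : crank_frame 11 6 frame11.
Proof.
split=> //.
- move=> x size_x; rewrite /index_iota !subn0 /= !big_cons !big_nil /=.
  case: x size_x => [|x0 [|x1 [|x2 [|x3 [|x4 [|x5 [|x6 [|x7 [|x8 [|x9 [|x10 []]]]]]]]]]]]
      //= _ sum_x.
  case/dvdzP=> z zE.
  exists [:: x2 + x3 + 2 * x4 + 2 * x5 + 2 * x6 + 3 * x7 + 3 * x8 + 4 * x9 + 4 * x10 - 5 * z - 3;
      x1 + x2 + x3 + x4 + x5 + 2 * x6 + 2 * x7 + 2 * x8 + 2 * x9 + 2 * x10 - 2 * z - 1;
      x2 + x3 + x4 + 2 * x5 + 2 * x6 + 2 * x7 + 3 * x8 + 3 * x9 + 4 * x10 - 4 * z - 2;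
      x4; x6 + x7 + x8 + x9 + x10 - z;
      - x1 - x2 - x3 - 2 * x4 - 2 * x5 - 3 * x6 - 3 * x7 - 3 * x8 - 4 * x9 - 4 * x10 + 4 * z + 2;
      - x2 - x3 - x4 - 2 * x5 - 2 * x6 - 3 * x7 - 3 * x8 - 3 * x9 - 4 * x10 + 4 * z + 2;
      x5 + x6 + x7 + x8 + x9 + x10 - z; - x6;
      x1 + x2 + 2 * x3 + 2 * x4 + 2 * x5 + 3 * x6 + 3 * x7 + 3 * x8 + 4 * x9 + 4 * x10 - 4 * z - 2;
      x5 + x6 + x7 + x8 + x9 + 2 * x10 - 2 * z - 1].
  split=> //; first by rewrite !big_cons big_nil; lia.
  by congr [:: _; _; _; _; _; _; _; _; _; _; _] => /=; lia.
- move=> a b size_a size_b.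
  case: a size_a => [|a0 [|a1 [|a2 [|a3 [|a4 [|a5 [|a6 [|a7 [|a8 [|a9 [|a10 []]]]]]]]]]]] //= _.
  case: b size_b => [|b0 [|b1 [|b2 [|b3 [|b4 [|b5 [|b6 [|b7 [|b8 [|b9 [|b10 []]]]]]]]]]]] //= _.
  rewrite !big_cons !big_nil => sum_a sum_b; rewrite /frame11 /=.
  by case=> *; congr [:: _; _; _; _; _; _; _; _; _; _; _]; lia.
- move=> a size_a; rewrite /index_iota !subn0 /= !big_cons !big_nil /=.

   by case: a size_a => [|a0 [|a1 [|a2 [|a3 [|a4 [|a5 [|a6 [|a7 [|a8 [|a9 [|a10 []]]]]]]]]]]] //= _; ring.
- move=> a size_a; rewrite /size_form /index_iota !subn0 /= !big_cons !big_nil /=.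
  case: a size_a => [|a0 [|a1 [|a2 [|a3 [|a4 [|a5 [|a6 [|a7 [|a8 [|a9 [|a10 []]]]]]]]]]]] //= _.
  rewrite !big_cons big_nil => sum_a.
  have -> : a0 = 1 - (a1 + a2 + a3 + a4 + a5 + a6 + a7 + a8 + a9 + a10) by lia.
  ring.
- move=> a size_a; rewrite /seq_crank /index_iota !subn0 /= !big_cons !big_nil /=.
  case: a size_a => [|a0 [|a1 [|a2 [|a3 [|a4 [|a5 [|a6 [|a7 [|a8 [|a9 [|a10 []]]]]]]]]]]] //= _.
  rewrite !big_cons big_nil => sum_a.
  by lia.
Qed.

Theorem theorem3p9 (n : nat) :
  [/\ laurent_dvd ('Phi_5)%:F (core_crank_poly 5 (5 * n + 4))%:F,
      laurent_dvd ('Phi_7)%:F (core_crank_poly 7 (7 * n + 5))%:F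
    & laurent_dvd ('Phi_11)%:F (core_crank_poly 11 (11 * n + 6))%:F].
Proof.
split.
- exact: core_crank_poly_dvd frame5P.
- exact: core_crank_poly_dvd frame7P.
- exact: core_crank_poly_dvd frame11P.
Qed.
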